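(* For a positive integer $n$, let $X_n$ denote the total height of a rooted labeled tree chosen uniformly at random among all $n^{n-1}$ rooted labeled trees on the vertex set $\{1,\dots,n\}$, and let $$W_n := \frac{n!}{n^{n-1}}\sum_{k=0}^{n-2}\frac{n^k}{k!}.$$ Then $$\operatorname{Var}(X_n) = -W_n^2 - \frac{17}{6}\, n W_n + \frac{5}{3}\, n^2 (n-1),$$ and, as $n\to\infty$, $$\operatorname{Var}(X_n) \sim \left(\frac{5}{3}-\frac{\pi}{2}\right) n^3 .$$ Consequently, the coefficient of variation $\sqrt{\operatorname{Var}(X_n)}/\mathbb{E}[X_n]$ tends, as $n\to\infty$, to $$\frac{\sqrt{2}}{6}\,\frac{\sqrt{60-18\pi}}{\sqrt{\pi}} = 0.2470484847\dots$$
   Context: A rooted labeled tree on $n$ vertices is a tree on the vertex set $\{1,\dots,n\}$ together with a distinguished vertex, the root. The height of a vertex is its graph distance to the root. The total height of a rooted labeled tree is the sum of the heights of all its vertices. All expectations and variances are taken with respect to the uniform distribution on the set of $n^{n-1}$ rooted labeled trees on $\{1,\dots,n\}$. The notation $a_n\sim b_n$ means $a_n/b_n\to 1$. It is known that $\mathbb{E}[X_n]=W_n$ and $W_n\sim \sqrt{\pi/2}\,n^{3/2}$.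
   Formalization: The printed decimal 0.2470484847... is wrong in its ninth and tenth digits: the limit equals sqrt(10/(3 pi) - 1) = 0.24704848501..., so the formal statement asserts the digits 0.2470484850... instead. *)

(* Defs.v *)
From HB Require Import structures.
From mathcomp Require Import all_boot all_order all_algebra.
From mathcomp Require Import all_classical all_reals all_analysis.

Set Implicit Arguments.
Unset Strict Implicit.
Unset Printing Implicit Defensive.

Import Order.TTheory GRing.Theory Num.Theory.
Import numFieldNormedType.Exports.

Local Open Scope ring_scope.

Section Trees.
Variable T : finType.
Implicit Types (E : {set {set T}}) (x y : T).

Definition simple_graph E : Prop := forall e, e \in E -> #|e| = 2.

Definition adj E : rel T := fun x y => [set x; y] \in E.

Definition connected_graph E : Prop := forall x y, connect (adj E) x y.

(* The two-item sequence [:: x; y] is a [ucycle] for every edge {x, y}: cycles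
   in the sense of graph theory are those with at least three vertices. *)
Definition acyclic_graph E : Prop :=
  forall c : seq T, ucycle (adj E) c -> (size c <= 2)%N.

Definition is_tree E : Prop :=
  [/\ simple_graph E, connected_graph E & acyclic_graph E].

Definition walk_of_length E (k : nat) x y : bool :=
  [exists p : k.-tuple T, path (adj E) x p && (last x p == y)].

(* The least length of a walk from x to y: if there is one, it is less than
   #|T|; the value is #|T| if x and y are not connected. *)
Definition graph_dist E x y : nat :=
  find (fun k => walk_of_length E k x y) (iota 0 #|T|).

End Trees.

(* A rooted labeled tree is a pair (edge set, root); the vertex set
   {1, ..., n} is represented by 'I_n. *)
Definition rooted_trees (n : nat) : {set {set {set 'I_n}} * 'I_n} :=
  [set t | `[< is_tree t.1 >]].

Definition height n (t : {set {set 'I_n}} * 'I_n) (v : 'I_n) : nat :=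
  graph_dist t.1 v t.2.

Definition total_height n (t : {set {set 'I_n}} * 'I_n) : nat :=
  (\sum_(v < n) height t v)%N.

Section Uniform.
Variables (R : realType) (T : finType).

(* Expectation and variance of f under the uniform distribution on A. *)
Definition unif_mean (A : {set T}) (f : T -> R) : R :=
  (\sum_(t in A) f t) / #|A|%:R.

Definition unif_var (A : {set T}) (f : T -> R) : R :=
  unif_mean A (fun t => (f t - unif_mean A f) ^+ 2).

End Uniform.

Section TotalHeight.
Variable R : realType.

Definition EX (n : nat) : R :=
  unif_mean (rooted_trees n) (fun t => (total_height t)%:R).

Definition VarX (n : nat) : R :=
  unif_var (rooted_trees n) (fun t => (total_height t)%:R).

Definition W (n : nat) : R :=
  (n`!)%:R / n%:R ^+ n.-1 * \sum_(0 <= k < n.-1) n%:R ^+ k / (k`!)%:R.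

Definition asymp_equiv (a b : nat -> R) : Prop :=
  ((fun n => a n / b n) @ \oo --> (1 : R))%classic.

(* The number 0.d_1 d_2 ... d_m *)
Definition decimal (ds : seq nat) : R :=
  \sum_(i < size ds) (nth 0%N ds i)%:R / 10 ^+ i.+1.

(* x = 0.d_1 d_2 ... d_m..., the digits being truncated and not rounded. *)
Definition has_decimal_expansion (x : R) (ds : seq nat) : Prop :=
  decimal ds <= x < decimal ds + 10 ^- size ds.

End TotalHeight.

(* Main.v *)
Require Import Defs.
From HB Require Import structures.
From mathcomp Require Import all_boot all_order all_algebra.
From mathcomp Require Import all_classical all_reals all_analysis.
From mathcomp Require Import ring lra zify.
Import Order.TTheory GRing.Theory Num.Theory.
Import numFieldNormedType.Exports.
Local Open Scope ring_scope.

(* A tree rooted at r is the same as its parent map, a self-map of the vertices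
   fixing r under which every vertex eventually reaches r. More generally, let
   forest S be the set of maps fixing S pointwise under which every vertex
   reaches S. Choose s in S. A vertex x <> s hanging from s has a last ancestor
   y before s, and cutting the edge from y to s turns the forest on S into a
   forest on y |: S in which x hangs from y and is one step closer to its root.
   The sums, over all forests on S, of products of at most two depths of
   vertices hanging from prescribed roots therefore satisfy linear recurrences
   in m = n - #|S|. Their solutions are n ^+ m times an expression that is affine
   in e, where e m = 1 + m / n * e m.-1 and e 0 = 1; since
   W n = n * (e n.-1 - 1), the mean and the variance of the total height come
   out of the case S = [set r].
   For the asymptotics, e n.-1 is the sum over j of the products over i <= j of
   1 - i / n, which are compared with exp (- j ^+ 2 / (2 * n)); the Riemann
   sums of the Gaussian give e n.-1 ~ sqrt (pi * n / 2). *)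

Set Implicit Arguments.
Unset Strict Implicit.
Unset Printing Implicit Defensive.

(** * Forests as parent maps *)

Section Forests.
Variable T : finType.
Implicit Types (S : {set T}) (f : {ffun T -> T}) (s x y : T).

Definition forest S : {set {ffun T -> T}} :=
  [set f : {ffun T -> T} | [forall x in S, f x == x] &&
    `[< forall x, exists k, iter k f x \in S >]].

(** The default [0] is taken only at vertices that never reach [S]; a map in [forest S] has none. *)
Definition depth S f x : nat :=
  if pselect (exists k, iter k f x \in S) is left h then ex_minn h else 0%N.

Definition root S f x : T := iter (depth S f x) f x.

(** Used with [s \in S] to hang [y] from the root [s], and with [s = y] to make [y] a root. *)
Definition upd f y s : {ffun T -> T} := [ffun x => if x == y then s else f x].

Lemma forestP S f : reflect ((forall x, x \in S -> f x = x) /\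
    (forall x, exists k, iter k f x \in S)) (f \in forest S).
Proof.
rewrite inE; apply: (iffP andP) => -[h1 h2]; split.
- by move=> x xS; apply/eqP; exact: (forall_inP h1).
- exact/asboolP.
- by apply/forall_inP => x xS; apply/eqP/h1.
- exact/asboolP.
Qed.

(** Induction on the number of steps needed to reach [S], phrased without [depth]. *)
Lemma forest_ind S f (P : T -> Prop) : f \in forest S ->
  (forall x, x \in S -> P x) -> (forall x, x \notin S -> P (f x) -> P x) ->
  forall x, P x.
Proof.
move=> /forestP[_ fr] PS Pf x; have [k] := fr x.
elim: k x => [|k IH] x; first exact: PS.
by rewrite iterSr; have [/PS//|xS /IH] := boolP (x \in S); exact: Pf.
Qed.

Lemma depth_in S f x : x \in S -> depth S f x = 0%N.
Proof.
rewrite /depth => xS; case: pselect => // h.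
by case: ex_minnP => m _ /(_ 0%N xS); rewrite leqn0 => /eqP.
Qed.

Lemma depth_step S f x : f \in forest S -> x \notin S ->
  depth S f x = (depth S f (f x)).+1.
Proof.
move=> /forestP[_ fr] xS; rewrite /depth.
case: pselect => [h|/(_ (fr x))//]; case: pselect => [h'|/(_ (fr (f x)))//].
case: ex_minnP => -[|m]; first by rewrite /= (negPf xS).
rewrite iterSr => mS mmin; case: ex_minnP => p pS pmin.
by apply/eqP; rewrite eqSS eqn_leq -ltnS mmin ?iterSr// pmin.
Qed.

Lemma root_in S f x : x \in S -> root S f x = x.
Proof. by move=> xS; rewrite /root depth_in. Qed.

Lemma root_step S f x : f \in forest S -> x \notin S ->
  root S f x = root S f (f x).
Proof. by move=> fS xS; rewrite /root depth_step// iterSr. Qed.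

Lemma root_mem S f x : f \in forest S -> root S f x \in S.
Proof.
move=> fS; move: x; apply: (forest_ind fS) => [x xS|x xS IH]; first by rewrite root_in.
by rewrite root_step.
Qed.

Lemma forest_upd S f y s : s \in S -> y \notin S -> f \in forest (y |: S) ->
  upd f y s \in forest S.
Proof.
move=> sS yS fS; have /forestP[fid _] := fS; apply/forestP; split.
  move=> x xS; rewrite ffunE; case: eqP => [xy|_]; first by rewrite -xy xS in yS.
  by rewrite fid// inE xS orbT.
apply: (forest_ind fS) => [x|x].
  rewrite !inE => /orP[/eqP ->|xS]; last by exists 0%N.
  by exists 1%N; rewrite /= ffunE eqxx.
rewrite !inE negb_or => /andP[xy xS] [k kS]; exists k.+1.
by rewrite iterSr ffunE (negPf xy).
Qed.

Lemma forest_cut S f y : y \notin S -> f \in forest S ->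
  upd f y y \in forest (y |: S).
Proof.
move=> yS fS; have /forestP[fid _] := fS; apply/forestP; split.
  by move=> x; rewrite !inE ffunE; case: eqP => //= _; exact: fid.
apply: (forest_ind fS) => [x xS|x xS [k kS]].
  by exists 0%N; rewrite /= inE xS orbT.
have [->|xy] := eqVneq x y; first by exists 0%N; rewrite /= !inE eqxx.
by exists k.+1; rewrite iterSr ffunE (negPf xy).
Qed.

Lemma root_upd S f y s x : s \in S -> y \notin S -> f \in forest (y |: S) ->
  root S (upd f y s) x =
  if root (y |: S) f x == y then s else root (y |: S) f x.
Proof.
move=> sS yS fS; have gS := forest_upd sS yS fS.
move: x; apply: (forest_ind fS) => [x|x].
  rewrite !inE => /orP[/eqP ->|xS].
    rewrite (root_in (S := _ |: _)) ?inE ?eqxx//.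
    by rewrite root_step// ffunE eqxx root_in.
  rewrite !root_in ?inE ?xS ?orbT//.
  by case: eqP => // xy; rewrite -xy xS in yS.
move=> xN IH; rewrite (root_step fS xN); move: xN IH.
rewrite !inE negb_or => /andP[xy xS].
by rewrite (root_step gS xS) ffunE (negPf xy).
Qed.

Lemma depth_upd S f y s x : s \in S -> y \notin S -> f \in forest (y |: S) ->
  depth S (upd f y s) x =
  (depth (y |: S) f x + (root (y |: S) f x == y))%N.
Proof.
move=> sS yS fS; have gS := forest_upd sS yS fS.
move: x; apply: (forest_ind fS) => [x|x].
  rewrite !inE => /orP[/eqP ->|xS].
    rewrite (root_in (S := _ |: _)) ?inE ?eqxx//.
    by rewrite depth_step// ffunE eqxx !depth_in// !inE eqxx.
  rewrite root_in ?inE ?xS ?orbT// !depth_in ?inE ?xS ?orbT//.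
  by case: eqP => // xy; rewrite -xy xS in yS.
move=> xN IH; rewrite (root_step fS xN) (depth_step fS xN); move: xN IH.
rewrite !inE negb_or => /andP[xy xS].
by rewrite (depth_step gS xS) ffunE (negPf xy) => ->.
Qed.

Lemma upd_id f y s : f y = s -> upd f y s = f.
Proof. by move=> fy; apply/ffunP => x; rewrite ffunE; case: eqP => // ->. Qed.

Lemma updK f y s t : upd (upd f y s) y t = upd f y t.
Proof. by apply/ffunP => x; rewrite !ffunE; case: eqP. Qed.

(* [iter (depth S f x).-1 f x] is the last ancestor of x before its root. *)
Lemma last_ancestor_cut S f s x y : f \in forest S -> s \in S ->
    y \notin S -> f y = s ->
  [&& x != s, root S f x == s & iter (depth S f x).-1 f x == y] =
  (root (y |: S) (upd f y y) x == y).
Proof.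
move=> fS sS yS fy; have gS := forest_cut yS fS.
move: x; apply: (forest_ind fS) => [x xS|x xS IH].
  rewrite !root_in ?inE ?xS ?orbT//.
  have -> : (x == y) = false by apply/eqP => xy; rewrite -xy xS in yS.
  by case: (x == s).
have xs : x != s by apply: contraNneq xS => ->.
rewrite xs/= root_step// depth_step//=; have [fxS|fxS] := boolP (f x \in S).
  rewrite root_in// depth_in//=; have [->|xy] := eqVneq x y.
    by rewrite root_in ?inE ?eqxx// fy eqxx.
  rewrite (root_step gS) ?inE ?(negPf xy)//= andbF ffunE (negPf xy).
  rewrite root_in ?inE ?fxS ?orbT//.
  by apply/esym/negbTE; apply: contraNneq yS => <-.
have xy : x != y by apply: contraNneq fxS => ->; rewrite fy.
rewrite (root_step gS) ?inE ?(negPf xy)//= ffunE (negPf xy) -IH.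
have -> : f x != s by apply: contraNneq fxS => ->.
by rewrite (depth_step fS fxS) -iterSr.
Qed.

Section Peel.
Variable R : nmodType.

(** The vertex [s] itself gives the first sum. The other vertices of its tree are sorted by their
    last ancestor [y] before [s], and [upd f y y] runs over all of [forest (y |: S)] as [f] runs
    over the forests on [S] with [f y = s]. *)
Lemma peel S s (Psi : {ffun T -> T} -> T -> R) : s \in S ->
  \sum_(f in forest S) \sum_(x | root S f x == s) Psi f x =
  \sum_(f in forest S) Psi f s +
  \sum_(y | y \notin S) \sum_(f in forest (y |: S))
    \sum_(x | root (y |: S) f x == y) Psi (upd f y s) x.
Proof.
move=> sS.
transitivity (\sum_(f in forest S) (Psi f s +
    \sum_(y | (y \notin S) && (f y == s))
      \sum_(x | root (y |: S) (upd f y y) x == y) Psi f x)).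
  apply: eq_bigr => f fS; rewrite (bigD1 s) ?root_in//=; congr (_ + _).
  rewrite (partition_big (fun x => iter (depth S f x).-1 f x)
     (fun y => (y \notin S) && (f y == s))) /=; last first.
    move=> x /andP[/eqP rx xs].
    have xS : x \notin S.
      by apply: contra xs => xS; rewrite -rx root_in.
    move: rx; rewrite /root depth_step//= => rx; rewrite rx eqxx andbT.
    (* The last ancestor lies outside [S], since [S] is reached only at the next step. *)
    move: x {xs rx} xS; apply: (forest_ind fS) => [x ->//|x _ IH xS].
    have [fxS|fxS] := boolP (f x \in S); first by rewrite depth_in.
    by rewrite (depth_step fS fxS) iterSr; exact: IH.
  apply: eq_bigr => y /andP[yS /eqP fy]; apply: eq_bigl => x.
  by rewrite -(last_ancestor_cut _ fS sS yS fy) andbA (andbC (_ != _)).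
rewrite big_split/=; congr (_ + _).
rewrite (exchange_big_dep (fun y => y \notin S))/=; last first.
  by move=> f y _ /andP[].
apply: eq_bigr => y yS.
rewrite (reindex_onto (fun g => upd g y s) (fun f => upd f y y)) /=; last first.
  by move=> f /and3P[fS _ /eqP fy]; rewrite updK upd_id.
apply: eq_big => [g|g].
  rewrite yS ffunE eqxx eqxx/= andbT updK; apply/andP/idP.
    by case=> gS /eqP <-; rewrite -(updK _ _ s); exact: forest_cut.
  move=> gS; split; first exact: forest_upd.
  have /forestP[gid _] := gS; apply/eqP/upd_id/gid.
  by rewrite !inE eqxx.
by move=> /andP[_ /eqP ->].
Qed.

End Peel.
End Forests.

(** * Moments of the depth *)

Section Moments.
Variables (R : numFieldType) (T : finType).
Implicit Types (S : {set T}) (s t x y z : T) (g : nat -> R) (h : nat -> nat -> R).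

Definition moment g S s : R :=
  \sum_(f in forest S) \sum_(x | root S f x == s) g (depth S f x).

Definition moment2 h S s t : R :=
  \sum_(f in forest S) \sum_(x | root S f x == s)
    \sum_(z | root S f z == t) h (depth S f x) (depth S f z).

Lemma momentD g g1 g2 S s : (forall d, g d = g1 d + g2 d) ->
  moment g S s = moment g1 S s + moment g2 S s.
Proof.
move=> gD; rewrite /moment -big_split; apply: eq_bigr => f _.
by rewrite -big_split; apply: eq_bigr => x _.
Qed.

Lemma moment2D h h1 h2 S s t : (forall d e, h d e = h1 d e + h2 d e) ->
  moment2 h S s t = moment2 h1 S s t + moment2 h2 S s t.
Proof.
move=> hD; rewrite /moment2 -big_split; apply: eq_bigr => f _.
rewrite -big_split; apply: eq_bigr => x _.
by rewrite -big_split; apply: eq_bigr => z _.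
Qed.

Lemma eq_moment g1 g2 S s : g1 =1 g2 -> moment g1 S s = moment g2 S s.
Proof. by move=> /funext ->. Qed.

Lemma moment_cst0 S s : moment (fun=> 0) S s = 0.
Proof. by rewrite /moment big1// => f _; rewrite big1. Qed.

Lemma moment2C h S s t : moment2 h S s t = moment2 (fun d e => h e d) S t s.
Proof. by apply: eq_bigr => f _; rewrite exchange_big. Qed.

(** By [peel]: [s] has depth zero, and every other vertex of its tree is one step closer to [y] than
    to [s], hence the shift of [g]. *)
Lemma moment_rec g S s : s \in S ->
  moment g S s = g 0%N * #|forest S|%:R +
    \sum_(y | y \notin S) moment (fun d => g d.+1) (y |: S) y.
Proof.
move=> sS; rewrite /moment peel//; congr (_ + _).
  rewrite mulr_natr -sumr_const; apply: eq_bigr => f fS.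
  by rewrite depth_in.
apply: eq_bigr => y yS; apply: eq_bigr => f fS; apply: eq_bigr => x /eqP rx.
by rewrite depth_upd// rx eqxx addn1.
Qed.

Lemma root_upd_neq S (f : {ffun T -> T}) y s t z :
  s \in S -> y \notin S -> t \in S -> t != s -> f \in forest (y |: S) ->
  (root S (upd f y s) z == t) = (root (y |: S) f z == t).
Proof.
move=> sS yS tS ts fS; rewrite root_upd//; case: (eqVneq (root _ f z) y) => // ->.
by rewrite eq_sym (negPf ts); apply/esym/negbTE; apply: contraNneq yS => ->.
Qed.

(** Only the tree at [s] is cut, so [z] keeps its root [t] and its depth: the second argument of [h]
    is not shifted. *)
Lemma moment2_rec_neq h S s t : s \in S -> t \in S -> t != s ->
  moment2 h S s t = moment (h 0%N) S t +
    \sum_(y | y \notin S) moment2 (fun d e => h d.+1 e) (y |: S) y t.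
Proof.
move=> sS tS ts; rewrite /moment2 peel//; congr (_ + _).
  by apply: eq_bigr => f fS; rewrite depth_in.
apply: eq_bigr => y yS; apply: eq_bigr => f fS; apply: eq_bigr => x /eqP rx.
rewrite depth_upd// rx eqxx addn1; apply: eq_big => [z|z].
  exact: root_upd_neq.
rewrite root_upd_neq// => /eqP rz; rewrite depth_upd// rz.
have -> : (t == y) = false by apply: contraNF yS => /eqP <-.
by rewrite addn0.
Qed.

(** Cutting at [y] leaves two places for [z]: the rest of the tree at [s], where its depth is
    unchanged, or the tree at [y], where its depth drops by one together with that of [x]. *)
Lemma moment2_rec_eq h S s : s \in S ->
  moment2 h S s s = moment (h 0%N) S s +
    \sum_(y | y \notin S) (moment2 (fun d e => h d.+1 e) (y |: S) y s +
       moment2 (fun d e => h d.+1 e.+1) (y |: S) y y).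
Proof.
move=> sS; rewrite /moment2 peel//; congr (_ + _).
  by apply: eq_bigr => f fS; rewrite depth_in.
apply: eq_bigr => y yS; rewrite -big_split; apply: eq_bigr => f fS/=.
rewrite -big_split; apply: eq_bigr => x /eqP rx /=.
have sy : s != y by apply: contraNneq yS => <-.
rewrite depth_upd// rx eqxx addn1 addrC (bigID (fun z => root (y |: S) f z == y))/=.
congr (_ + _); apply: eq_big => z; rewrite root_upd//.
- by case: (root _ f z == y); rewrite ?eqxx ?andbF.
- case: (eqVneq (root _ f z) y) => [rz _|]; last by rewrite andbF.
  by rewrite depth_upd// rz eqxx addn1.
- case: (eqVneq (root _ f z) y) => [->|]; rewrite ?andbF ?andbT//.
  by rewrite eq_sym (negPf sy).
- case: (eqVneq (root _ f z) y) => [rz|rz _]; first by rewrite andbF.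
  by rewrite depth_upd// (negPf rz) addn0.
Qed.

(** * Closed forms of the moments *)

Let n : R := #|T|%:R.

(* By [moment_depth] below, one plus the mean depth, over all forests with n - m
   prescribed roots, of a vertex hanging from a given root. *)
Fixpoint tail (n : R) (m : nat) : R :=
  if m is m'.+1 then 1 + m%:R / n * tail n m' else 1.

Lemma sum_moment1 S : \sum_(s in S) moment (fun=> 1) S s = n * #|forest S|%:R.
Proof.
rewrite /moment exchange_big/= mulr_natr -sumr_const; apply: eq_bigr => f fS.
rewrite (exchange_big_dep predT)//= /n -sum1_card natr_sum; apply: eq_bigr => x _.
rewrite (bigD1 (root S f x)) ?root_mem ?eqxx//= big1 ?addr0// => s.
by move=> /andP[/andP[_ /eqP ->]]; rewrite eqxx.
Qed.

Lemma forestT : forest [set: T] = [set [ffun x => x]].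
Proof.
apply/setP => f; apply/forestP/set1P => [[fid _]|->].
  by apply/ffunP => x; rewrite ffunE fid.
by split=> [x _|x]; [rewrite ffunE|exists 0%N; rewrite inE].
Qed.

Lemma card_compl m S : (#|S| + m)%N = #|T| -> #|[pred y | y \notin S]| = m.
Proof. by move=> Sm; rewrite -(cardC (mem S)) in Sm; move: Sm => /addnI ->. Qed.

(** The moments will depend on [S] only through its size, so the sums over [y] in the recurrences
    have equal terms. *)
Lemma sum_compl m S (F : T -> R) c : (#|S| + m.+1)%N = #|T| ->
  (forall y, y \notin S -> (#|y |: S| + m)%N = #|T| -> F y = c) ->
  \sum_(y | y \notin S) F y = m.+1%:R * c.
Proof.
move=> Sm Fc; transitivity (\sum_(y | y \notin S) c).
  by apply: eq_bigr => y yS; apply: Fc => //; rewrite cardsU1 yS -Sm addnS.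
by rewrite sumr_const (card_compl Sm) mulr_natl.
Qed.

Lemma full_set S : (#|S| + 0)%N = #|T| -> S = [set: T].
Proof.
by rewrite addn0 => Sn; apply/eqP; rewrite eqEcard finset.subsetT cardsT Sn leqnn.
Qed.

Lemma sum_full S (F : T -> R) : (#|S| + 0)%N = #|T| ->
  \sum_(y | y \notin S) F y = 0.
Proof. by move=> /full_set ->; rewrite big_pred0// => y; rewrite inE. Qed.

Lemma natr_card m S : (#|S| + m)%N = #|T| -> #|S|%:R = n - m%:R.
Proof. by rewrite /n => <-; rewrite natrD addrK. Qed.

Lemma natr_cardT_neq0 (x : T) : n != 0.
Proof. by rewrite pnatr_eq0 -lt0n; apply/card_gt0P; exists x. Qed.

(* Counting the vertices root by root, [n * #|forest S|] is the sum over s in S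
   of [moment (fun=> 1) S s], which determines both quantities by induction. *)
Lemma card_forest m S : (#|S| + m)%N = #|T| -> n != 0 ->
  #|forest S|%:R = (n - m%:R) * n ^+ m / n /\
  (forall s, s \in S -> moment (fun=> 1) S s = n ^+ m).
Proof.
move=> + n0; elim: m S => [S Sm|m IH S Sm].
  have F1 : #|forest S|%:R = 1 :> R by rewrite (full_set Sm) forestT cards1.
  rewrite F1 expr0 subr0 mulr1 divff//; split=> // s sS.
  by rewrite moment_rec// sum_full// F1 mulr1 addr0.
have M s : s \in S ->
    moment (fun=> 1) S s = #|forest S|%:R + m.+1%:R * n ^+ m.
  move=> sS; rewrite moment_rec// mul1r; congr (_ + _).
  apply: sum_compl Sm _ => y yS Sy.
  by have [_ ->] := IH _ Sy; rewrite ?inE ?eqxx.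
have m0 : m.+1%:R != 0 :> R by rewrite pnatr_eq0.
(* Writing [N] for the number of forests, [sum_moment1] reads
   [(n - m.+1) * (N + m.+1 * n ^+ m) = n * N], in which [m.+1] cancels. *)
have F : #|forest S|%:R = (n - m.+1%:R) * n ^+ m.
  apply: (mulfI m0); have := sum_moment1 S.
  rewrite (eq_bigr (fun=> #|forest S|%:R + m.+1%:R * n ^+ m))//.
  rewrite sumr_const -[X in X = _]mulr_natl (natr_card Sm) => /eqP.
  rewrite -subr_eq0 => /eqP E; apply/eqP; rewrite -subr_eq0; apply/eqP.
  by apply: oppr_inj; rewrite oppr0 -[RHS]E; ring.
split=> [|s sS]; first by rewrite F exprS; field.
by rewrite M// F exprS; ring.
Qed.

Lemma moment_depth m S s : (#|S| + m)%N = #|T| -> s \in S ->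
  moment (fun d => d%:R) S s = n ^+ m * (tail n m - 1).
Proof.
have n0 := natr_cardT_neq0 s; elim: m S s n0 => [|m IH] S s n0 Sm sS;
  rewrite moment_rec// mul0r add0r.
  by rewrite sum_full//= subrr mulr0.
rewrite (sum_compl (c := n ^+ m * tail n m) Sm).
  by rewrite exprS/=; field.
move=> y yS Sy; have yyS : y \in y |: S by rewrite !inE eqxx.
rewrite (@momentD _ (fun d => d%:R) (fun=> 1)) => [|d]; last by rewrite natr1.
by rewrite IH//; have [_ ->//] := card_forest Sy n0; ring.
Qed.

(** This closed form and those below are verified by induction on [m]: [c] is the value of the
    summand at [y |: S], which has [n - m] elements, and [field] checks the recurrence once
    [tail n m.+1] is unfolded. *)
Lemma moment2_neq_1 m S s t : (#|S| + m)%N = #|T| -> s \in S -> t \in S ->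
  t != s -> moment2 (fun _ _ => 1) S s t = n ^+ m * tail n m.
Proof.
have n0 := natr_cardT_neq0 s; elim: m S s t n0 => [|m IH] S s t n0 Sm sS tS ts;
  rewrite moment2_rec_neq// (card_forest Sm n0).2//.
  by rewrite sum_full//= expr0; ring.
rewrite (sum_compl (c := n ^+ m * tail n m) Sm).
  by rewrite exprS/=; field.
move=> y yS Sy; rewrite IH ?inE ?eqxx ?tS ?orbT//.
by apply: contraNneq yS => <-.
Qed.

Lemma moment2_neq_l m S s t : (#|S| + m)%N = #|T| -> s \in S -> t \in S ->
  t != s -> moment2 (fun d _ => d%:R) S s t =
  n ^+ m * (n - #|S|%:R * tail n m).
Proof.
have n0 := natr_cardT_neq0 s; elim: m S s t n0 => [|m IH] S s t n0 Sm sS tS ts;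
  rewrite moment2_rec_neq// moment_cst0 (natr_card Sm).
  by rewrite sum_full//= expr0; ring.
rewrite (sum_compl (c := n ^+ m * (n - (n - m%:R) * tail n m + tail n m)) Sm).
  by rewrite exprS/=; field.
move=> y yS Sy; have yyS : y \in y |: S by rewrite !inE eqxx.
have ty : t != y by apply: contraNneq yS => <-.
rewrite (@moment2D _ (fun d _ => d%:R) (fun _ _ => 1)) => [|d e];
  last by rewrite natr1.
rewrite IH ?(@moment2_neq_1 m) ?inE ?eqxx ?tS ?orbT//.
by rewrite (natr_card Sy); ring.
Qed.

Lemma moment2_neq_r m S s t : (#|S| + m)%N = #|T| -> s \in S -> t \in S ->
  t != s -> moment2 (fun _ d => d%:R) S s t =
  n ^+ m * (n - #|S|%:R * tail n m).
Proof.
by move=> Sm sS tS ts; rewrite moment2C (@moment2_neq_l m)// eq_sym.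
Qed.

(** Since [d.+1 * e = d * e + e], the inhomogeneous part of the recurrence comes from
    [moment2_neq_r]. *)
Lemma moment2_neq_lr m S s t : (#|S| + m)%N = #|T| -> s \in S -> t \in S ->
  t != s -> moment2 (fun d e => d%:R * e%:R) S s t =
  n ^+ m * ((#|S|%:R * (#|S|%:R + 1) + n) / 2 * tail n m
            - n * #|S|%:R / 2 - n).
Proof.
have n0 := natr_cardT_neq0 s; elim: m S s t n0 => [|m IH] S s t n0 Sm sS tS ts;
  rewrite moment2_rec_neq//;
  (rewrite (@eq_moment _ (fun=> 0)); last by move=> d; rewrite mul0r);
  rewrite moment_cst0 (natr_card Sm).
  by rewrite sum_full//= expr0; field.
rewrite (sum_compl (c := n ^+ m * (((n - m%:R) * ((n - m%:R) + 1) + n) / 2 * tail n m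
            - n * (n - m%:R) / 2 - (n - m%:R) * tail n m)) Sm).
  by rewrite exprS/=; field.
move=> y yS Sy; have yyS : y \in y |: S by rewrite !inE eqxx.
have ty : t != y by apply: contraNneq yS => <-.
rewrite (@moment2D _ (fun d e => d%:R * e%:R) (fun _ d => d%:R)) => [|d e]; last first.
  by rewrite -natr1; ring.
rewrite IH ?(@moment2_neq_r m) ?inE ?eqxx ?tS ?orbT//.
by rewrite (natr_card Sy); field.
Qed.

Lemma moment2_eq_1 m S s : (#|S| + m)%N = #|T| -> s \in S ->
  moment2 (fun _ _ => 1) S s s = n ^+ m * ((1 - #|S|%:R) * tail n m + n).
Proof.
have n0 := natr_cardT_neq0 s; elim: m S s n0 => [|m IH] S s n0 Sm sS;
  rewrite moment2_rec_eq// (card_forest Sm n0).2// (natr_card Sm).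
  by rewrite sum_full//= expr0; ring.
rewrite (sum_compl (c := n ^+ m * (tail n m + (1 - (n - m%:R)) * tail n m + n)) Sm).
  by rewrite exprS/=; field.
move=> y yS Sy; have yyS : y \in y |: S by rewrite !inE eqxx.
have sy : s != y by apply: contraNneq yS => <-.
rewrite IH// (@moment2_neq_1 m) ?inE ?eqxx ?sS ?orbT//.
by rewrite (natr_card Sy); field.
Qed.

Lemma moment2_eq_l m S s : (#|S| + m)%N = #|T| -> s \in S ->
  moment2 (fun d _ => d%:R) S s s =
  n ^+ m * ((#|S|%:R * (#|S|%:R - 1) + n) * tail n m - n * #|S|%:R).
Proof.
have n0 := natr_cardT_neq0 s; elim: m S s n0 => [|m IH] S s n0 Sm sS;
  rewrite moment2_rec_eq// moment_cst0 (natr_card Sm).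
  by rewrite sum_full//= expr0; ring.
(* The first two terms of [c] collect [moment2_neq_l], [moment2_neq_1] and [moment2_eq_1]; the last
   two are the induction hypothesis. *)
rewrite (sum_compl (c := n ^+ m * (2 * n - 2 * (n - m.+1%:R) * tail n m +
   ((n - m%:R) * ((n - m%:R) - 1) + n) * tail n m - n * (n - m%:R))) Sm).
  by rewrite exprS/=; field.
move=> y yS Sy; have yyS : y \in y |: S by rewrite !inE eqxx.
have sy : s != y by apply: contraNneq yS => <-.
do 2!(rewrite (@moment2D (fun d _ => d.+1%:R) (fun d _ => d%:R) (fun _ _ => 1))
  => [|d e]; last by rewrite natr1).
rewrite IH ?(@moment2_eq_1 m) ?(@moment2_neq_1 m) ?(@moment2_neq_l m)
  ?inE ?eqxx ?sS ?orbT//.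
by rewrite (natr_card Sy); field.
Qed.

Lemma moment2_eq_r m S s : (#|S| + m)%N = #|T| -> s \in S ->
  moment2 (fun _ d => d%:R) S s s =
  n ^+ m * ((#|S|%:R * (#|S|%:R - 1) + n) * tail n m - n * #|S|%:R).
Proof. by move=> Sm sS; rewrite moment2C (@moment2_eq_l m). Qed.

(** For a single root, [k = 1], the coefficient of [tail n m] becomes [- 17 / 6 * n]: this is the
    source of the fraction in the variance. *)
Lemma moment2_eq_lr m S s : (#|S| + m)%N = #|T| -> s \in S ->
  let k : R := #|S|%:R in
  moment2 (fun d e => d%:R * e%:R) S s s =
  n ^+ m * ((- 5 / 6 * k ^+ 3 + k ^+ 2 / 2 + (1 / 3 - 5 / 2 * n) * k - n / 3) * tail n m
    + 5 / 6 * n * k ^+ 2 + n / 3 * k + 5 / 3 * n ^+ 2).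
Proof.
have n0 := natr_cardT_neq0 s; elim: m S s n0 => [|m IH] S s n0 Sm sS /=;
  rewrite moment2_rec_eq//;
  (rewrite (@eq_moment _ (fun=> 0)); last by move=> d; rewrite mul0r);
  rewrite moment_cst0 (natr_card Sm).
  by rewrite sum_full//= expr0; field.
(* [k] is the size of [y |: S]. The first line of [c] gathers all but the induction hypothesis: what
   [d.+1 * e = d * e + e] gives for the roots [y], [s], and what [d.+1 * e.+1 = d * e + e + d + 1]
   adds for [y], [y]. *)
pose k : R := n - m%:R.
rewrite (sum_compl (c := n ^+ m * (
   (5 / 2 * k ^+ 2 - 7 / 2 * k + 5 / 2 * n + 1) * tail n m + n - 5 / 2 * n * k +
   (- 5 / 6 * k ^+ 3 + k ^+ 2 / 2 + (1 / 3 - 5 / 2 * n) * k - n / 3) * tail n m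
    + 5 / 6 * n * k ^+ 2 + n / 3 * k + 5 / 3 * n ^+ 2)) Sm).
  by rewrite [n ^+ m.+1]exprS /k/=; field.
move=> y yS Sy; have yyS : y \in y |: S by rewrite !inE eqxx.
have sy : s != y by apply: contraNneq yS => <-.
rewrite (@moment2D _ (fun d e => d%:R * e%:R) (fun _ d => d%:R) _ y s)
  => [|d e]; last first.
  by rewrite -natr1; ring.
rewrite (@moment2D _ (fun d e => d.+1%:R * e%:R) (fun d _ => d.+1%:R) _ y y)
  => [|d e]; last first.
  by rewrite -[e.+1%:R]natr1; ring.
rewrite (@moment2D _ (fun d e => d%:R * e%:R) (fun _ d => d%:R) _ y y)
  => [|d e]; last first.
  by rewrite -natr1; ring.
rewrite (@moment2D (fun d _ => d.+1%:R) (fun d _ => d%:R) (fun _ _ => 1))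
  => [|d e]; last by rewrite natr1.
rewrite IH ?(@moment2_eq_1 m) ?(@moment2_eq_l m) ?(@moment2_eq_r m)
  ?(@moment2_neq_r m) ?(@moment2_neq_lr m) ?inE ?eqxx ?sS ?orbT//.
by rewrite (natr_card Sy) -/k; field.
Qed.

End Moments.

(** * Rooted trees and parent maps *)

Section ParentFunctions.
Variable T : finType.
Implicit Types (E : {set {set T}}) (f g : {ffun T -> T}) (r x y z : T).

Lemma walkP E k x y : reflect
  (exists p, [/\ size p = k, path (adj E) x p & last x p = y])
  (walk_of_length E k x y).
Proof.
apply: (iffP existsP) => [[p /andP[pp /eqP py]]|[p [pk pp py]]].
  by exists p; rewrite size_tuple.
have pk' : size p == k by apply/eqP.
by exists (Tuple pk'); rewrite /= pp py eqxx.
Qed.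

Lemma graph_dist_le E k x y : walk_of_length E k x y -> (k < #|T|)%N ->
  (graph_dist E x y <= k)%N.
Proof.
move=> w kT; rewrite leqNgt; apply/negP => /(before_find 0%N).
by rewrite nth_iota// add0n w.
Qed.

Lemma graph_dist_walk E x y : connect (adj E) x y ->
  walk_of_length E (graph_dist E x y) x y.
Proof.
move=> /connectP[p0 /shortenP[p pp pu _] ->].
(* Without repeated vertices a walk has fewer than [#|T|] steps, so the search made by [graph_dist]
   succeeds. *)
have pT : (size p < #|T|)%N.
  by rewrite -[(size p).+1]/(size (x :: p)) -(card_uniqP pu) max_card.
have hw : has (fun k => walk_of_length E k x (last x p)) (iota 0 #|T|).
  apply/hasP; exists (size p); first by rewrite mem_iota.
  by apply/walkP; exists p.
have dT : (graph_dist E x (last x p) < #|T|)%N.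
  by rewrite /graph_dist -[X in (_ < X)%N](size_iota 0) -has_find.
by have := nth_find 0%N hw; rewrite nth_iota.
Qed.

Lemma graph_dist_step E x y : connect (adj E) x y -> x != y ->
  exists2 z, adj E x z & (graph_dist E z y < graph_dist E x y)%N.
Proof.
move=> cxy xy; have /walkP[[|z p]/= [sp pp py]] := graph_dist_walk cxy.
  by rewrite py eqxx in xy.
move: pp => /andP[xz zp]; exists z => //; rewrite -sp ltnS.
apply: graph_dist_le; first by apply/walkP; exists p.
by rewrite -ltnS [(size p).+1]sp ltnS /graph_dist -[X in (_ <= X)%N](size_iota 0)
  find_size.
Qed.

(** The root is left out because its loop [f r = r] would yield a one-element set. *)
Definition edges f r : {set {set T}} := [set [set x; f x] | x in [set~ r]].

Lemma adj_edges f r x y : adj (edges f r) x y =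
  ((x != r) && (y == f x)) || ((y != r) && (x == f y)).
Proof.
rewrite /adj /edges; apply/imsetP/orP => [[z]|].
  rewrite !inE => zr e.
  have := set21 z (f z); have := set22 z (f z); rewrite -e !inE.
  have := set21 x y; have := set22 x y; rewrite e !inE.
  move=> /orP[]/eqP -> /orP[]/eqP ->; rewrite !eqxx ?orbT ?orbb ?zr /=; auto.
  - by rewrite eq_sym => -> _; left.
  - by move=> _ /eqP fz; rewrite -!fz zr eqxx; left.
case=> /andP[zr /eqP ->]; [exists x|exists y] => //; rewrite ?inE//.
exact: finset.setUC.
Qed.

Section OneForest.
Variables (f : {ffun T -> T}) (r : T).
Hypothesis fr : f \in forest [set r].
Let d := depth [set r] f.
Let E := edges f r.

Lemma depth_root : d r = 0%N.
Proof. by rewrite /d depth_in ?inE. Qed.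

Lemma depth_parent x : x != r -> d x = (d (f x)).+1.
Proof. by move=> xr; rewrite /d (depth_step fr)// inE. Qed.

Lemma parent_neq x : x != r -> f x != x.
Proof.
move=> /depth_parent dx; apply/eqP => fx.
by rewrite fx in dx; elim: (d x) dx => // ? IH [].
Qed.

Lemma adj_depth x y : adj E x y -> (d x <= (d y).+1)%N.
Proof.
rewrite adj_edges => /orP[]/andP[/depth_parent dz /eqP e].
  by rewrite dz e.
by rewrite dz e; lia.
Qed.

Lemma walk_depth x p : path (adj E) x p -> last x p = r -> (d x <= size p)%N.
Proof.
elim: p x => [|y p IH] x /=; first by move=> _ ->; rewrite depth_root.
move=> /andP[/adj_depth dxy yp] lp; apply: leq_trans dxy _.
by rewrite ltnS; exact: IH.
Qed.

Lemma walk_to_root x : walk_of_length E (d x) x r.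
Proof.
apply/walkP; move: x; apply: (forest_ind fr) => [x|x].
  by rewrite inE => /eqP ->; exists [::]; rewrite depth_root.
rewrite inE => xr [p [sp pp lp]]; exists (f x :: p); split => //=.
  by rewrite depth_parent// sp.
by rewrite pp adj_edges xr eqxx.
Qed.

Lemma connect_edges x y : connect (adj E) x y.
Proof.
have sE : connect_sym (adj E).
  by apply: sym_connect_sym => a b; rewrite !adj_edges orbC.
have cr z : connect (adj E) z r.
  by have /walkP[p [_ zp <-]] := walk_to_root z; apply/connectP; exists p.
by apply: connect_trans (cr x) _; rewrite sE.
Qed.

(** Along an edge the depth changes by at most one, so no walk to [r] is shorter than the one
    through the parents. *)
Lemma graph_dist_edges x : graph_dist E x r = d x.
Proof.
apply/eqP; rewrite eqn_leq; apply/andP; split; last first.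
  have /walkP[p [<- pp lp]] := graph_dist_walk (connect_edges x r).
  exact: walk_depth.
apply: graph_dist_le; first exact: walk_to_root.
(* [graph_dist] searches lengths below [#|T|] only; a walk without repetitions shows that [d x] is
   one of them. *)
have /connectP[p0 /shortenP[p pp pu _] lp] := connect_edges x r.
apply: leq_ltn_trans (walk_depth pp (esym lp)) _.
by rewrite -[(size p).+1]/(size (x :: p)) -(card_uniqP pu) max_card.
Qed.

(** For acyclicity: on a cycle, both neighbours of a vertex of greatest depth must be its parent,
    which is impossible when there are at least three vertices. *)
Lemma is_tree_edges : is_tree E.
Proof.
split.
- by move=> e /imsetP[x]; rewrite !inE => xr ->; rewrite cards2 eq_sym parent_neq.
- exact: connect_edges.
move=> c cE; rewrite leqNgt; apply/negP => c3.
have [x0 x0c] : exists x0, x0 \in c.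
  by case: c c3 {cE} => // x0 c _; exists x0; rewrite mem_head.
have [x xc xmax] : exists2 x, x \in c & forall y, y \in c -> (d y <= d x)%N.
  by case: (@arg_maxnP _ x0 (mem c) d x0c) => x xc xmax; exists x.
have [i c' ec] := rot_to xc.
have adjx y : y \in c -> adj E x y || adj E y x -> y = f x.
  move=> /xmax dy; rewrite !adj_edges [X in _ || X]orbC orbb.
  case/orP=> /andP[xr /eqP//] ey.
  by have := depth_parent xr; rewrite -ey; lia.
move: cE; rewrite -(rot_ucycle i) ec => /andP[].
have : size (rot i c) = size (x :: c') by rewrite ec.
rewrite size_rot; case: c' ec => [|y [|z c'']] ec /= sc; rewrite ?sc// in c3 *.
rewrite rcons_path => /and4P[xy yz _ zx] /and3P[_ + _].
have cP w : w \in [:: x, y, z & c''] -> w \in c by rewrite -ec mem_rot.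
(* The cycle has been rotated to start at the deepest vertex [x]; its second and last vertices both
   equal [f x], against the absence of repetitions. *)
rewrite (adjx y) ?xy//; last by rewrite cP// !inE eqxx orbT.
rewrite -(adjx (last z c'')) ?zx ?orbT ?mem_last//.
by rewrite cP// 2!inE mem_last !orbT.
Qed.

End OneForest.

(** Distances to [r] recover the depth from the edge set, and [f x] is the neighbour of [x] that is
    closer to [r]. *)
Lemma edges_inj r : {in forest [set r] &, injective (edges^~ r)}.
Proof.
move=> f g fr gr e; apply/ffunP => x.
have dfg y : depth [set r] f y = depth [set r] g y.
  by rewrite -!graph_dist_edges//= e.
have [->|xr] := eqVneq x r.
  have /forestP[fid _] := fr; have /forestP[gid _] := gr.
  by rewrite fid ?gid ?inE.
have : adj (edges f r) x (f x) by rewrite adj_edges xr eqxx.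
rewrite e adj_edges xr/= => /orP[/eqP//|/andP[fxr /eqP xg]].
have := depth_parent gr fxr; rewrite -xg -dfg -dfg (depth_parent fr xr); lia.
Qed.

(** Any neighbour closer to [r] will do; by [parentP] there is one in a tree when [x != r], so the
    default [x] is not taken. *)
Definition parent E r : {ffun T -> T} :=
  [ffun x => if x == r then r else
    odflt x [pick y | adj E x y && (graph_dist E y r < graph_dist E x r)%N]].

Lemma parentP E r x : is_tree E -> x != r -> adj E x (parent E r x) /\
  (graph_dist E (parent E r x) r < graph_dist E x r)%N.
Proof.
move=> [_ cE _] xr; rewrite ffunE (negPf xr); case: pickP => [y /andP[]//|no].
have [y xy yx] := graph_dist_step (cE x r) xr.
by have := no y; rewrite xy yx.
Qed.

Lemma parent_forest E r : is_tree E -> parent E r \in forest [set r].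
Proof.
move=> tE; apply/forestP; split=> [x|x].
  by rewrite inE => /eqP ->; rewrite ffunE eqxx.
have [m] := ubnP (graph_dist E x r); elim: m x => // m IH x.
have [->|xr] := eqVneq x r; first by exists 0%N; rewrite /= inE.
have [_ xd] := parentP tE xr; rewrite ltnS => /(leq_trans xd)/IH[k kr].
by exists k.+1; rewrite iterSr.
Qed.

(** An edge of [E] that joins no vertex to its parent would close the path between its ends in the
    parent graph into a cycle of [E]. *)
Lemma edges_parent E r : is_tree E -> edges (parent E r) r = E.
Proof.
move=> tE; have fr := parent_forest r tE; have [sE cE aE] := tE.
have symE x y : adj E x y = adj E y x by rewrite /adj finset.setUC.
have subE x y : adj (edges (parent E r) r) x y -> adj E x y.
  rewrite adj_edges => /orP[]/andP[/(parentP tE)[xp _] /eqP ->//].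
  by rewrite symE.
apply/setP => e; apply/idP/idP => [/imsetP[x]|eE].
  by rewrite !inE => /(parentP tE)[xp _] ->.
have /eqP/cards2P[x [y [xy ee]]] := sE _ eE; rewrite {}ee in eE *.
rewrite -/(adj (edges (parent E r) r) x y); apply/negPn/negP => Nxy.
have /connectP[p0 /shortenP[p pp pu _] lp] := connect_edges fr x y.
have : ucycle (adj E) (x :: p).
  rewrite /ucycle pu andbT /= rcons_path (sub_path subE pp) -lp.
  by rewrite -symE.
(* Acyclicity leaves a path of at most one step: none would give [x = y], one would make the missing
   edge a parent edge. *)
move=> /aE; case: p pp lp {pu} => [|z [|//]] /=.
  by move=> _ yx; rewrite yx eqxx in xy.
by rewrite andbT => xz zy; rewrite zy xz in Nxy.
Qed.

Lemma trees_edges r : [set E : {set {set T}} | `[< is_tree E >]] =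
  edges^~ r @: forest [set r].
Proof.
apply/setP => E; rewrite inE; apply/asboolP/imsetP => [tE|[f fr ->]].
  by exists (parent E r); [exact: parent_forest|rewrite edges_parent].
exact: is_tree_edges.
Qed.

End ParentFunctions.

Section RootedTrees.
Variables (R : nmodType) (n : nat).

Lemma sum_rooted_trees (F : {set {set 'I_n}} * 'I_n -> R) :
  \sum_(t in rooted_trees n) F t =
  \sum_r \sum_(f in forest [set r]) F (edges f r, r).
Proof.
rewrite (partition_big snd predT)//=; apply: eq_bigr => r _.
rewrite -(big_imset (fun E => F (E, r)) (@edges_inj _ r)) -trees_edges.
rewrite (reindex_onto (fun E => (E, r)) fst) /=; last first.
  by move=> [E s] /= /andP[_ /eqP ->].
by apply: eq_bigl => E; rewrite !inE /= !eqxx !andbT.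
Qed.

Lemma total_height_edges (f : {ffun 'I_n -> 'I_n}) r : f \in forest [set r] ->
  total_height (edges f r, r) = (\sum_v depth [set r] f v)%N.
Proof. by move=> fr; apply: eq_bigr => v _; exact: graph_dist_edges. Qed.

End RootedTrees.

(** * The variance *)

Section Variance.
Variable R : realType.

Lemma unif_varE (T : finType) (A : {set T}) (f : T -> R) : #|A|%:R != 0 :> R ->
  unif_var A f = unif_mean A (fun t => f t ^+ 2) - unif_mean A f ^+ 2.
Proof.
move=> A0; rewrite /unif_var; set m := unif_mean A f.
have Sf : \sum_(t in A) f t = m * #|A|%:R by rewrite /m /unif_mean divfK.
rewrite /unif_mean (eq_bigr (fun t => f t ^+ 2 - 2 * m * f t + m ^+ 2)); last first.
  by move=> t _; ring.
rewrite big_split/= sumrB sumr_const -mulr_sumr Sf -[m ^+ 2 *+ _]mulr_natr.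
by field.
Qed.

Lemma tailE (n : R) m : n != 0 ->
  tail n m = m`!%:R / n ^+ m * \sum_(0 <= k < m.+1) n ^+ k / k`!%:R.
Proof.
move=> n0; elim: m => [|m IH]; first by rewrite big_nat1 /= expr0 fact0; field.
rewrite big_nat_recr//= {}IH mulrDr addrC factS natrM exprS.
have m0 : m`!%:R != 0 :> R by rewrite pnatr_eq0 -lt0n fact_gt0.
have m1 : m.+1%:R != 0 :> R by rewrite pnatr_eq0.
by congr (_ + _); field; rewrite n0 expf_neq0 ?nat1r ?m0 ?m1.
Qed.

(** The sum in [W] stops one term before that in [tailE]; the missing term contributes [1] to
    [tail], hence the subtraction. *)
Lemma W_tail m : W R m.+1 = m.+1%:R * (tail m.+1%:R m - 1).
Proof.
have n0 : m.+1%:R != 0 :> R by rewrite pnatr_eq0.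
have m0 : m`!%:R != 0 :> R by rewrite pnatr_eq0 -lt0n fact_gt0.
rewrite tailE// big_nat_recr//= /W factS natrM/=.
by field; rewrite ?nat1r ?(expf_neq0 m n0) ?n0 ?m0.
Qed.

Section Fixed.
Variable m : nat.
Let n : R := m.+1%:R.

Let n0 : n != 0. Proof. by rewrite pnatr_eq0. Qed.

Let card_r (r : 'I_m.+1) : (#|[set r]| + m)%N = #|'I_m.+1|.
Proof. by rewrite cards1 card_ord. Qed.

(** Each of the [n] roots carries [n ^+ m / n] trees, by [card_forest] with [n - m = 1]. *)
Lemma card_rooted_trees : #|rooted_trees m.+1|%:R = n ^+ m :> R.
Proof.
rewrite -sum1_card natr_sum sum_rooted_trees.
transitivity (\sum_(r < m.+1) n ^+ m / n); last first.
  by rewrite sumr_const card_ord -mulr_natl -/n; field.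
apply: eq_bigr => r _; rewrite sumr_const.
have [] := card_forest (R := R) (card_r r); first by rewrite card_ord.
by move=> -> _; rewrite card_ord -/n /n -natr1; field; rewrite natr1.
Qed.

Lemma sum_root (f : {ffun 'I_m.+1 -> 'I_m.+1}) r (F : 'I_m.+1 -> R) :
  f \in forest [set r] ->
  \sum_(x | root [set r] f x == r) F x = \sum_x F x.
Proof.
by move=> fr; apply: eq_bigl => x; have := root_mem x fr; rewrite inE => ->.
Qed.

Lemma EX_W : EX R m.+1 = W R m.+1.
Proof.
rewrite /EX /unif_mean card_rooted_trees sum_rooted_trees W_tail -/n.
rewrite (eq_bigr (fun=> n ^+ m * (tail n m - 1))) => [|r _].
  by rewrite sumr_const card_ord -mulr_natl -/n; field; rewrite expf_neq0.
have := moment_depth R (card_r r) (set11 r); rewrite card_ord -/n => <-.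
apply: eq_bigr => f fr.
by rewrite sum_root// total_height_edges// natr_sum.
Qed.

Lemma EX_sqr :
  unif_mean (rooted_trees m.+1) (fun t => (total_height t)%:R ^+ 2) =
  - 17 / 6 * n * W R m.+1 + 5 / 3 * n ^+ 2 * (n - 1).
Proof.
rewrite /unif_mean card_rooted_trees sum_rooted_trees W_tail -/n.
rewrite (eq_bigr (fun=> n ^+ m *
  ((- 17 / 6 * n) * (tail n m - 1) + 5 / 3 * n * (n - 1)))) => [|r _].
  by rewrite sumr_const card_ord -mulr_natl -/n; field; rewrite expf_neq0.
have := moment2_eq_lr R (card_r r) (set11 r); rewrite card_ord -/n cards1 /= => M.
(* All vertices hang from the single root [r], so the square of the total height expands into the
   second moment with [s = t = r]. *)
transitivity (moment2 (fun d e : nat => d%:R * e%:R : R) [set r] r r); last first.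
  by rewrite M; field.
apply: eq_bigr => f fr.
rewrite total_height_edges// natr_sum expr2 big_distrl/= sum_root//.
by apply: eq_bigr => x _; rewrite sum_root// big_distrr.
Qed.

Lemma VarX_W : VarX R m.+1 =
  - W R m.+1 ^+ 2 - 17 / 6 * n * W R m.+1 + 5 / 3 * n ^+ 2 * (n - 1).
Proof.
rewrite /VarX unif_varE; last by rewrite card_rooted_trees expf_neq0.
by rewrite EX_sqr -/(EX R m.+1) EX_W; ring.
Qed.

End Fixed.
End Variance.

(** * Comparison with the Gaussian integral *)

Section GaussSums.
Variable R : realType.
Implicit Types a b x : R.
Local Notation G := (@gauss_integral_proof.integral0_gauss R).
Local Notation mu := (@lebesgue_measure R).

Lemma gauss_integrable a b : mu.-integrable `[a, b]%classic (EFin \o @gauss_fun R).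
Proof.
apply: continuous_compact_integrable; first exact: segment_compact.
by apply: continuous_subspaceT; exact: continuous_gauss_fun.
Qed.

Lemma gauss_fun_le a b : 0 <= a -> a <= b -> gauss_fun b <= gauss_fun a.
Proof.
by move=> a0 ab; rewrite ler_expR lerN2 ler_pXn2r// ?nnegrE// (le_trans a0).
Qed.

Lemma gauss_integral_increment a b : 0 <= a -> a <= b ->
  (b - a) * gauss_fun b <= G b - G a <= (b - a) * gauss_fun a.
Proof.
move=> a0; rewrite le_eqVlt => /predU1P[->|ab]; first by rewrite !subrr !mul0r lexx.
rewrite /gauss_integral_proof.integral0_gauss Rintegral_itvB//;
  [|exact: gauss_integrable|by rewrite bnd_simp ltW].
have mab : fine (mu `]a, b]%classic) = b - a.
  by rewrite lebesgue_measure_itv/= lte_fin ab.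
have iab : mu.-integrable `]a, b]%classic (EFin \o @gauss_fun R).
  apply: (integrableS _ _ _ (gauss_integrable a b)) => //.
  by apply: subset_itvr; rewrite bnd_simp.
have icst u v c : mu.-integrable `[u, v]%classic (EFin \o (fun=> c)).
  apply: continuous_compact_integrable; first exact: segment_compact.
  by apply: continuous_subspaceT => x; exact: cvg_cst.
have cab c : mu.-integrable `]a, b]%classic (EFin \o (fun=> c)).
  by apply: (integrableS _ _ _ (icst a b c)) => //; apply: subset_itvr; rewrite bnd_simp.
rewrite -mab ![fine _ * _]mulrC -!Rintegral_cst//.
by apply/andP; split; apply: le_Rintegral => //= x; rewrite in_itv/= => /andP[ax xb];
  apply: gauss_fun_le => //; [exact: le_trans a0 (ltW ax)|exact: ltW].
Qed.

Lemma gauss_integral0 : G 0 = 0.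
Proof. by rewrite /gauss_integral_proof.integral0_gauss set_itv1 Rintegral_set1. Qed.

Lemma gauss_integral_ndecr a b : 0 <= a -> a <= b -> G a <= G b.
Proof.
move=> a0 ab; have /andP[+ _] := gauss_integral_increment a0 ab.
rewrite -subr_ge0; apply: le_trans.
by rewrite mulr_ge0 ?subr_ge0// gauss_fun_ge0.
Qed.

(** The square of [G] tends to [pi / 4]; as [G] is nonnegative, the root can be taken. *)
Lemma gauss_integral_cvg : (G x @[x --> +oo%R] --> (Num.sqrt pi / 2 : R))%classic.
Proof.
have -> : Num.sqrt pi / 2 = Num.sqrt (pi / 4) :> R.
  rewrite sqrtrM ?pi_ge0// sqrtrV// (_ : 4 = 2 ^+ 2); last by rewrite -natrX.
  by rewrite sqrtr_sqr ger0_norm.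
rewrite (_ : G = fun x => Num.sqrt (G x ^+ 2)); last first.
  apply/funext => x; rewrite sqrtr_sqr ger0_norm//.
  exact: gauss_integral_proof.integral0_gauss_ge0.
apply: continuous_cvg; first exact: sqrt_continuous.
exact: gauss_integral_proof.cvg_integral0_gauss_sqr.
Qed.

Lemma gauss_integral_le a : 0 <= a -> G a <= Num.sqrt pi / 2.
Proof.
move=> a0; apply: (cvgr_to_ge gauss_integral_cvg).
by near=> x; apply: gauss_integral_ndecr.
Unshelve. all: end_near. Qed.

(** A Riemann sum of mesh [1 / s] at right ends, hence below the integral of a decreasing
    function. *)
Lemma gauss_sum_le (s : R) J : 0 < s ->
  \sum_(j < J) gauss_fun (j.+1%:R / s) <= s * G (J%:R / s).
Proof.
move=> s0; have mono k : k%:R / s <= k.+1%:R / s.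
  by rewrite ler_pM2r ?invr_gt0// ler_nat.
elim: J => [|J IH]; first by rewrite big_ord0 mul0r gauss_integral0 mulr0.
rewrite big_ord_recr/=; apply: le_trans (lerD IH (lexx _)) _.
rewrite -lerBrDl -mulrBr -ler_pdivrMl//.
have /andP[+ _] := @gauss_integral_increment (J%:R / s) (J.+1%:R / s)
  (divr_ge0 (ler0n _ _) (ltW s0)) (mono _).
by rewrite -mulrBl -natrB// subSnn mul1r.
Qed.

(** The same values now serve as left ends. The cell from [0] to [1 / s] is not covered, and costs
    at most [1] after scaling by [s]. *)
Lemma gauss_sum_ge (s : R) J : 0 < s ->
  s * G (J.+1%:R / s) - 1 <= \sum_(j < J) gauss_fun (j.+1%:R / s).
Proof.
move=> s0; have mono k : k%:R / s <= k.+1%:R / s.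
  by rewrite ler_pM2r ?invr_gt0// ler_nat.
elim: J => [|J IH].
  have /andP[_] := @gauss_integral_increment 0 (1 / s) (lexx _) (divr_ge0 ler01 (ltW s0)).
  rewrite big_ord0 gauss_integral0 !subr0 subr_le0 -ler_pdivlMl// => /le_trans; apply.
  by rewrite mulr1 mul1r ler_piMr ?invr_ge0 ?gauss_fun_le1// ltW.
rewrite big_ord_recr/=; apply: le_trans (lerD IH (lexx _)).
rewrite addrAC lerD2r -lerBlDl -mulrBr -ler_pdivlMl//.
have /andP[_ +] := @gauss_integral_increment (J.+1%:R / s) (J.+2%:R / s)
  (divr_ge0 (ler0n _ _) (ltW s0)) (mono _).
by rewrite -mulrBl -natrB// subSnn mul1r.
Qed.

End GaussSums.

(** * Gaussian bounds on [tail] *)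

Section TailAsymptotics.
Variable R : realType.
Local Notation G := (@gauss_integral_proof.integral0_gauss R).

Lemma tail_sum (n : R) m :
  tail n m = \sum_(j < m.+1) \prod_(i < j) ((m - i)%:R / n).
Proof.
elim: m => [|m IH]; first by rewrite big_ord1 big_ord0.
rewrite big_ord_recl big_ord0 /= IH mulr_sumr; congr (_ + _).
by apply: eq_bigr => j _; rewrite big_ord_recl subn0.
Qed.

Section Fixed.
Variable m : nat.
Let n : R := m.+1%:R.
Let n0 : 0 < n. Proof. by rewrite ltr0n. Qed.

Let p j : R := \prod_(i < j) ((m - i)%:R / n).

Let p_ge0 j : 0 <= p j.
Proof. by apply: prodr_ge0 => i _; rewrite divr_ge0// ltW. Qed.

Let factorE j : (j <= m)%N -> (m - j)%:R / n = 1 - j.+1%:R / n.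
Proof.
by move=> jm; rewrite natrB// /n -!natr1; field; rewrite natr1 lt0r_neq0.
Qed.

(** From [1 - x <= expR (- x)], the product is at most the exponential of [- j * (j + 1) / (2 * n)],
    which is below the Gaussian value. *)
Lemma prod_le_gauss j : (j <= m.+1)%N -> p j <= gauss_fun (j%:R / Num.sqrt (2 * n)).
Proof.
have tn : 0 <= 2 * n by rewrite mulr_ge0// ltW.
rewrite /gauss_fun exprMn exprVn sqr_sqrtr//.
elim: j => [_|j IH jm]; first by rewrite /p big_ord0 expr0n mul0r oppr0 expR0.
rewrite /p big_ord_recr/= -/(p j).
have h : (m - j)%:R / n <= expR (- (j.+1%:R / n)).
  by rewrite factorE//; exact: expR_ge1Dx.
apply: le_trans (ler_pM _ _ (IH (ltnW jm)) h) _ => //; first by rewrite divr_ge0// ltW.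
rewrite -expRD ler_expR -subr_ge0 (_ : _ - _ = (2 * n)^-1).
  by rewrite invr_ge0 mulr_ge0// ltW.
by rewrite -natr1; field; rewrite ?nat1r lt0r_neq0.
Qed.

(** Here [1 - x >= expR (- (x / (1 - x)))] for [x = j.+1 / n]. Bounding [x / (1 - x)] by
    [j.+1 / (n - M)] keeps a Gaussian shape, and the shift to [j.+1] absorbs the linear term of
    [j * (j + 1) / 2]. *)
Lemma prod_ge_gauss M j : (M <= m)%N -> (j <= M)%N ->
  gauss_fun (j.+1%:R / Num.sqrt (2 * (n - M%:R))) <= p j.
Proof.
move=> Mm; have nM : 0 < n - M%:R by rewrite subr_gt0 ltr_nat.
have tn : 0 <= 2 * (n - M%:R) by rewrite mulr_ge0// ltW.
rewrite /gauss_fun exprMn exprVn sqr_sqrtr//.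
elim: j => [_|j IH jM].
  by rewrite /p big_ord0 -[leRHS]expR0 ler_expR lerNl oppr0 divr_ge0 ?sqr_ge0.
rewrite /p big_ord_recr/= -/(p j).
have h : expR (- (j.+1%:R / (n - M%:R))) <= (m - j)%:R / n.
  have jm : (j < m)%N := leq_trans jM Mm.
  rewrite expRN -[leRHS]invrK lef_pV2 ?posrE ?expR_gt0 ?invr_gt0 ?divr_gt0
    ?ltr0n ?subn_gt0//.
  apply: le_trans (expR_ge1Dx _).
  have jn : 0 < n - j.+1%:R by rewrite subr_gt0 ltr_nat ltnS.
  have -> : ((m - j)%:R / n)^-1 = 1 + j.+1%:R / (n - j.+1%:R).
    by rewrite factorE ?(ltnW jm)//; field; rewrite !nat1r !lt0r_neq0.
  by rewrite lerD2l ler_pM2l// lef_pV2 ?posrE// lerB// ler_nat.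
apply: le_trans (ler_pM _ _ (IH (ltnW jM)) h); rewrite ?expR_ge0//.
rewrite -expRD ler_expR -subr_ge0 (_ : _ - _ = (2 * (n - M%:R))^-1).
  by rewrite invr_ge0 mulr_ge0// ltW.
by rewrite -[j.+2%:R]natr1 -[j.+1%:R]natr1; field; rewrite ?nat1r lt0r_neq0.
Qed.

Lemma tail_le : tail n m <= 1 + Num.sqrt (2 * n) * (Num.sqrt pi / 2).
Proof.
have s0 : 0 < Num.sqrt (2 * n) by rewrite sqrtr_gt0 mulr_gt0.
rewrite tail_sum big_ord_recl big_ord0 lerD2l.
apply: (@le_trans _ _ (\sum_(j < m) gauss_fun (j.+1%:R / Num.sqrt (2 * n)))).
  by apply: ler_sum => j _; apply: prod_le_gauss; rewrite ltnS ltnW//; exact: ltn_ord.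
apply: le_trans (gauss_sum_le _ s0) _; by rewrite ler_pM2l// gauss_integral_le.
Qed.

(** The terms beyond [M] are nonnegative and dropped. Inside [G], having [n] in place of [n - M]
    only makes the argument smaller. *)
Lemma tail_ge M : (M <= m)%N ->
  Num.sqrt (2 * (n - M%:R)) * G (M.+1%:R / Num.sqrt (2 * n)) - 1 <= tail n m.
Proof.
move=> Mm; have nM : 0 < n - M%:R by rewrite subr_gt0 ltr_nat.
have s0 : 0 < Num.sqrt (2 * (n - M%:R)) by rewrite sqrtr_gt0 mulr_gt0.
have t0 : 0 < Num.sqrt (2 * n) by rewrite sqrtr_gt0 mulr_gt0.
rewrite tail_sum; apply: (@le_trans _ _ (\sum_(j < M.+1) p j)).
  apply: (@le_trans _ _
    (\sum_(j < M.+1) gauss_fun (j.+1%:R / Num.sqrt (2 * (n - M%:R))))).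
    apply: le_trans (gauss_sum_ge _ s0); rewrite lerB// ler_pM2l//.
    apply: gauss_integral_ndecr; first by rewrite divr_ge0// ltW.
    apply: (@le_trans _ _ (M.+1%:R / Num.sqrt (2 * (n - M%:R)))).
      rewrite ler_pM2l ?ltr0n// lef_pV2 ?posrE// ler_sqrt; last by rewrite mulr_ge0// ltW.
      by rewrite ler_pM2l// lerBlDr lerDl.
    by rewrite ler_pM2r ?invr_gt0// ler_nat.
  by apply: ler_sum => j _; apply: prod_ge_gauss => //; rewrite -ltnS.
rewrite -!(big_mkord xpredT p) (big_cat_nat _ (n := M.+1) (p := m.+1))//=.
by rewrite lerDl; apply: sumr_ge0 => j _; exact: p_ge0.
Qed.

End Fixed.
End TailAsymptotics.

(** * Limit of the mean *)

Section Limits.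
Variable R : realType.
Local Notation G := (@gauss_integral_proof.integral0_gauss R).
Local Open Scope classical_set_scope.

Lemma sqrtn_cvgy : Num.sqrt (n%:R : R) @[n --> \oo] --> +oo.
Proof.
apply/cvgryPge => A; near=> n.
have [A0|A0] := ltP A 0; first by rewrite (le_trans (ltW A0)) ?sqrtr_ge0.
rewrite -(ger0_norm A0) -sqrtr_sqr ler_sqrt ?ler0n//.
near: n; exact: nbhs_infty_ger.
Unshelve. all: end_near. Qed.

Lemma sqrt_cvgy : Num.sqrt x @[x --> +oo%R] --> (+oo%R : set_system R).
Proof.
apply/cvgryPge => A; near=> x.
have [A0|A0] := ltP A 0; first by rewrite (le_trans (ltW A0)) ?sqrtr_ge0.
by rewrite -(ger0_norm A0) -sqrtr_sqr ler_wsqrtr.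
Unshelve. all: end_near. Qed.

Lemma sqrtn_inv_cvg0 : (Num.sqrt (n%:R : R))^-1 @[n --> \oo] --> (0 : R).
Proof.
apply/(gtr0_cvgV0 _).2/sqrtn_cvgy; near=> n.
by rewrite sqrtr_gt0 ltr0n; near: n; exact: nbhs_infty_gt.
Unshelve. all: end_near. Qed.

Let a n : R := Num.sqrt (Num.sqrt n%:R).

Let a_cvgy : a n @[n --> \oo] --> +oo.
Proof. exact: (cvg_comp _ _ sqrtn_cvgy sqrt_cvgy). Qed.

(* With n = b ^+ 4, cutting the sum at M = b ^+ 3 makes M / n vanish and
   M / sqrt n diverge. *)
Lemma tail_ge_fourth_root m (b : R) : 1 < b -> b ^+ 4 = m.+1%:R ->
  (Num.sqrt (2 * (1 - b^-1)) * G (b / Num.sqrt 2) - b ^- 2) * b ^+ 2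
  <= tail m.+1%:R m.
Proof.
move=> b1 bm; have b0 : 0 < b by apply: lt_trans b1.
pose M := Num.truncn (b ^+ 3).
have /andP[Ml Mr] : M%:R <= b ^+ 3 < M.+1%:R.
  by apply: truncn_itv; rewrite exprn_ge0// ltW.
have Mm : (M <= m)%N.
  rewrite -ltnS -(ltr_nat R) -bm; apply: le_lt_trans Ml _.
  by rewrite [b ^+ 4]exprS ltr_pMl ?exprn_gt0.
apply: le_trans (tail_ge R Mm).
rewrite mulrBl mulVf ?expf_neq0 ?lt0r_neq0// lerB// mulrAC.
have bb : Num.sqrt (2 * (1 - b^-1)) * b ^+ 2 = Num.sqrt (2 * (b ^+ 4 - b ^+ 3)).
  have -> : 2 * (b ^+ 4 - b ^+ 3) = 2 * (1 - b^-1) * (b ^+ 2) ^+ 2.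
    by field; rewrite lt0r_neq0.
  rewrite [RHS]sqrtrM ?sqrtr_sqr ?ger0_norm ?exprn_ge0 ?(ltW b0)//.
  by rewrite mulr_ge0// subr_ge0 invf_le1// ltW.
rewrite bb; apply: ler_pM; rewrite ?sqrtr_ge0 ?gauss_integral_proof.integral0_gauss_ge0//.
  by rewrite ler_wsqrtr// -bm ler_pM2l// lerB.
(* The argument of [G] is at least [b / Num.sqrt 2] because [b ^+ 3 < M.+1]. *)
apply: gauss_integral_ndecr; first by rewrite divr_ge0 ?sqrtr_ge0// ltW.
have -> : Num.sqrt (2 * m.+1%:R) = Num.sqrt 2 * b ^+ 2 :> R.
  by rewrite -bm (exprM _ 2 2) sqrtrM// sqrtr_sqr ger0_norm ?exprn_ge0// ltW.
have s2 : 0 < Num.sqrt 2 :> R by rewrite sqrtr_gt0.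
rewrite invfM mulrA mulrAC ler_pM2r ?invr_gt0//.
by rewrite ler_pdivlMr ?exprn_gt0// -exprS ltW.
Qed.

Lemma tail_cvg :
  tail n%:R n.-1 / Num.sqrt n%:R @[n --> \oo] --> (Num.sqrt 2 * (Num.sqrt pi / 2) : R).
Proof.
have s2 : 0 < Num.sqrt 2 :> R by rewrite sqrtr_gt0.
have aV : (a n)^-1 @[n --> \oo] --> (0 : R).
  apply/(gtr0_cvgV0 _).2/a_cvgy; near=> n.
  by rewrite !sqrtr_gt0 ltr0n; near: n; exact: nbhs_infty_gt.
(* The lower bound is [tail_ge_fourth_root] at [b = a n], the upper one is [tail_le], both divided
   by [Num.sqrt n%:R]. *)
apply: (@squeeze_cvgr _ _ _ _
  (fun n => Num.sqrt (2 * (1 - (a n)^-1)) * G (a n / Num.sqrt 2) - (a n)^-1 * (a n)^-1)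
  (fun n => (Num.sqrt n%:R)^-1 + Num.sqrt 2 * (Num.sqrt pi / 2))).
- near=> n; have : (1 < n)%N by near: n; exists 2%N.
  move: (n) => [//|m m0].
  have n0 : 0 < Num.sqrt m.+1%:R :> R by rewrite sqrtr_gt0 ltr0n.
  have a2 : a m.+1 ^+ 2 = Num.sqrt m.+1%:R by rewrite sqr_sqrtr// sqrtr_ge0.
  have a4 : a m.+1 ^+ 4 = m.+1%:R by rewrite (exprM _ 2 2) a2 sqr_sqrtr ?ler0n.
  rewrite ler_pdivlMr// ler_pdivrMr//; apply/andP; split.
    rewrite -a2 -invfM -expr2; apply: tail_ge_fourth_root => //.
    by rewrite -(@ltr_pXn2r _ 4) ?nnegrE ?sqrtr_ge0// expr1n a4 ltr1n.
  apply: le_trans (tail_le R m) _; rewrite [leRHS]mulrDl mulVf ?lt0r_neq0// lerD2l.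
  by rewrite sqrtrM// mulrAC.
- rewrite -[X in _ --> X]subr0 -[X in _ --> _ - X](mulr0 0).
  apply: cvgB; last exact: cvgM.
  apply: cvgM; last first.
    apply: (cvg_comp _ _ _ (@gauss_integral_cvg R)).
    apply: (cvg_comp a (fun x => x / Num.sqrt 2) a_cvgy).
    by apply: gt0_cvgMly; [rewrite invr_gt0|exact: cvg_id].
  have h : 2 * (1 - (a n)^-1) @[n --> \oo] --> (2 * (1 - 0) : R).
    by apply: cvgM; [exact: cvg_cst|apply: cvgB; [exact: cvg_cst|]].
  rewrite subr0 mulr1 in h.
  exact: (cvg_comp _ _ h (@sqrt_continuous R 2)).
- rewrite -[X in _ --> X]add0r.
  by apply: cvgD; [exact: sqrtn_inv_cvg0|exact: cvg_cst].
Unshelve. all: end_near. Qed.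

End Limits.

(** * Decimal bounds for pi *)

Section PiBounds.
Variable R : realType.

(** Partial sums of even length increase and those of odd length decrease, so two consecutive ones
    enclose all later ones. *)
Lemma alternating_series_bounds (t : nat -> R) (l : R) K :
  (forall k, 0 <= t k.+1 <= t k) ->
  (series (fun k => (-1) ^+ k * t k) @ \oo --> l)%classic ->
  \sum_(0 <= k < K.*2) (-1) ^+ k * t k <= l <=
  \sum_(0 <= k < K.*2.+1) (-1) ^+ k * t k.
Proof.
move=> tdecr; set u := fun k => _; set S := series u => Sl.
have SE j : S j.*2.+1 = S j.*2 + t j.*2.
  by rewrite /S /series/= big_nat_recr//= /u -signr_odd odd_double mul1r.
have SO j : S j.*2.+2 = S j.*2.+1 - t j.*2.+1.
  by rewrite /S /series/= big_nat_recr//= /u -signr_odd /= odd_double mulN1r.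
have bnd m : S K.*2 <= S (K + m).*2 /\ S (K + m).*2.+1 <= S K.*2.+1.
  elim: m => [|m [IHe IHo]]; first by rewrite addn0.
  have /andP[_ h1] := tdecr (K + m).*2.+1; have /andP[_ h2] := tdecr (K + m).*2.
  have e1 := SE (K + m).+1; have e2 := SO (K + m)%N; have e3 := SE (K + m)%N.
  by rewrite doubleS in e1; rewrite addnS doubleS; split; lra.
have nbnd n : (K.*2 <= n)%N -> S K.*2 <= S n <= S K.*2.+1.
  move=> Kn; have [m ->] : exists m, n = (odd n + (K + m).*2)%N.
    by exists (n./2 - K)%N; rewrite subnKC ?odd_double_half// -(doubleK K) half_leq.
  have [b1 b2] := bnd m; have /andP[h1 h2] := tdecr (K + m).*2.
  have h0 : 0 <= t (K + m).*2 by apply: le_trans h1 h2.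
  by move: b1 b2; case: (odd n); rewrite ?add1n ?add0n SE; lra.
apply/andP; split.
  by apply: (cvgr_to_ge Sl); exists K.*2 => // n /= /nbnd/andP[].
by apply: (cvgr_to_le Sl); exists K.*2 => // n /= /nbnd/andP[].
Qed.

Lemma sin_taylor_bounds (x : R) K : 0 <= x <= 1 ->
  \sum_(0 <= k < K.*2) (-1) ^+ k * (x ^+ k.*2.+1 / k.*2.+1`!%:R) <= sin x <=
  \sum_(0 <= k < K.*2.+1) (-1) ^+ k * (x ^+ k.*2.+1 / k.*2.+1`!%:R).
Proof.
move=> /andP[x0 x1]; apply: alternating_series_bounds.
  move=> k; rewrite divr_ge0 ?exprn_ge0//= ler_pM ?exprn_ge0 ?invr_ge0//.
    by rewrite ler_wiXn2l// doubleS ltnS leqW.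
  rewrite lef_pV2 ?posrE ?ltr0n ?fact_gt0// ler_nat; apply: leq_fact.
  by rewrite doubleS !ltnS leqW.
rewrite (_ : (fun k => _) = sin_coeff' x); first exact: cvg_sin_coeff'.
by apply/funext => k; rewrite /sin_coeff' mulrA.
Qed.

(** The triple angle formula and [sin (pi / 2) = 1] give [(s + 1) * (2 * s - 1) ^+ 2 = 0], and [s]
    is positive. *)
Lemma sin_pi6 : sin (pi / 6) = 1 / 2 :> R.
Proof.
set s := sin _; have pi2 := @pihalf_ge1 R; have pi0 := @pi_gt0 R.
have s0 : 0 < s by apply: sin_gt0_pihalf; apply/andP; split; lra.
have : sin (pi / 6 + (pi / 6 + pi / 6)) = 1 :> R.
  by rewrite -[RHS]sin_pihalf; congr sin; field.
rewrite sinD sinD cosD -/s; set c := cos _ => E.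
have cc : c * c = 1 - s * s by rewrite -!expr2 cos2sin2.
have E2 : (s + 1) * (2 * s - 1) ^+ 2 = 0.
  transitivity (1 - (s * (c * c - s * s) + c * (s * c + c * s)) +
    3 * s * (c * c - (1 - s * s))); first by ring.
  by rewrite E cc !subrr mulr0 addr0.
move/eqP: E2; rewrite mulf_eq0 sqrf_eq0 => /orP[]/eqP h; lra.
Qed.

(** Each Taylor term comes from the previous one with a small divisor [m], so that no large
    factorial is evaluated. *)
Lemma taylor_step (x : R) k m : m = (k.*2.+3 * k.*2.+2)%N ->
  x ^+ k.+1.*2.+1 / k.+1.*2.+1`!%:R =
  x ^+ k.*2.+1 / k.*2.+1`!%:R * (x ^+ 2 / m%:R).
Proof.
move=> mE; have m0 : m%:R != 0 :> R by rewrite pnatr_eq0 mE.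
have f0 : k.*2.+1`!%:R != 0 :> R by rewrite pnatr_eq0 -lt0n fact_gt0.
rewrite doubleS [k.*2.+3`!]factS [k.*2.+2`!]factS mulnA -mE natrM.
have -> : x ^+ k.*2.+3 = x ^+ k.*2.+1 * x ^+ 2 by rewrite -exprD addn2.
move: (m%:R : R) (_`!%:R : R) (x ^+ _.+1) m0 f0 => u w y u0 w0.
by field; rewrite u0 w0.
Qed.

(** As [sin] increases on the interval, bounding [pi] by [p] amounts to comparing [sin (p / 6)] with
    [1 / 2]; seven Taylor terms decide the lower bound and six the upper one. Writing the decimals
    in blocks keeps the numerals small. *)
Lemma pi_bounds : 3 + 1415 / 10 ^+ 4 + 926 / 10 ^+ 7 + 535 / 10 ^+ 10 < pi :> R /\
  pi < 3 + 1415 / 10 ^+ 4 + 926 / 10 ^+ 7 + 536 / 10 ^+ 10 :> R.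
Proof.
have pi2 := @pihalf_ge1 R.
have in_pihalf (y : R) : 0 <= y -> y <= 1 -> y \in `[- (pi / 2), pi / 2]%R.
  by move=> y0 y1; rewrite in_itv/=; apply/andP; split; lra.
have pi6 : pi / 6 \in `[- (pi / 2), pi / 2 : R]%R.
  by rewrite in_itv/=; apply/andP; split; lra.
split.
  set p : R := (X in X < _).
  have p0 : 0 <= p / 6 <= 1 by apply/andP; split; rewrite /p; lra.
  suff : p / 6 < pi / 6 by lra.
  rewrite -ltr_sin// ?in_pihalf//; [|by case/andP: p0|by case/andP: p0].
  have /andP[_ /le_lt_trans->//] := sin_taylor_bounds 3 p0.
  rewrite sin_pi6 !big_nat_recr// big_geq// (@taylor_step _ 5 156)//
    (@taylor_step _ 4 110)// (@taylor_step _ 3 72)// (@taylor_step _ 2 42)//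
    (@taylor_step _ 1 20)// (@taylor_step _ 0 6)//.
  rewrite -![0.*2]/0%N -![3.*2]/6%N -![1`!]/1%N /= /p; lra.
set p : R := (X in _ < X).
have p0 : 0 <= p / 6 <= 1 by apply/andP; split; rewrite /p; lra.
suff : pi / 6 < p / 6 by lra.
rewrite -ltr_sin// ?in_pihalf//; [|by case/andP: p0|by case/andP: p0].
have /andP[lo _] := sin_taylor_bounds 3 p0; apply: lt_le_trans lo.
rewrite sin_pi6 -[3.*2]/6%N !big_nat_recr// big_geq// (@taylor_step _ 4 110)//
  (@taylor_step _ 3 72)// (@taylor_step _ 2 42)// (@taylor_step _ 1 20)//
  (@taylor_step _ 0 6)//.
rewrite -![0.*2]/0%N -![1`!]/1%N /= /p; lra.
Qed.

End PiBounds.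

(** * Asymptotics of the variance *)

Section VarianceAsymptotics.
Variable R : realType.
Local Open Scope classical_set_scope.

Let L : R := Num.sqrt 2 * (Num.sqrt pi / 2).
Let w n : R := W R n / (n%:R * Num.sqrt n%:R).

Lemma sqr_W_limit : L ^+ 2 = pi / 2.
Proof. by rewrite exprMn sqr_sqrtr// exprMn sqr_sqrtr ?pi_ge0//; field. Qed.

Lemma W_limit_gt0 : 0 < L.
Proof. by rewrite mulr_gt0 ?divr_gt0 ?sqrtr_gt0 ?pi_gt0. Qed.

Lemma W_cvg : w n @[n --> \oo] --> L.
Proof.
have h : tail n%:R n.-1 / Num.sqrt n%:R - (Num.sqrt n%:R)^-1 @[n --> \oo] --> L.
  by rewrite -[L]subr0; apply: cvgB; [exact: tail_cvg|exact: sqrtn_inv_cvg0].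
apply: cvg_trans h; apply: near_eq_cvg; near=> n.
have : (0 < n)%N by near: n; exact: nbhs_infty_gt.
move: (n) => [//|m _]; rewrite /w W_tail /=.
by field; rewrite ?nat1r sqrtr_eq0 -ltNge ltr0n pnatr_eq0.
Unshelve. all: end_near. Qed.

(** After division by [n ^+ 3], the square of [W R n] tends to [pi / 2], while the term in
    [n * W R n] has order [1 / Num.sqrt n] and vanishes. *)
Lemma VarX_cvg : VarX R n / n%:R ^+ 3 @[n --> \oo] --> (5 / 3 - pi / 2 : R).
Proof.
have h : - w n ^+ 2 - 17 / 6 * (w n * (Num.sqrt n%:R)^-1) +
    5 / 3 * (1 - (Num.sqrt n%:R)^-1 * (Num.sqrt n%:R)^-1) @[n --> \oo] -->
    (- L ^+ 2 - 17 / 6 * (L * 0) + 5 / 3 * (1 - 0 * 0) : R).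
  have s0 := @sqrtn_inv_cvg0 R; have wL := W_cvg.
  apply: cvgD; last first.
    by apply: cvgM; [exact: cvg_cst|apply: cvgB; [exact: cvg_cst|exact: cvgM]].
  apply: cvgB.
    by apply: cvgN; under eq_fun do rewrite expr2; rewrite expr2; exact: cvgM.
  by apply: cvgM; [exact: cvg_cst|exact: cvgM].
have -> : 5 / 3 - pi / 2 = - L ^+ 2 - 17 / 6 * (L * 0) + 5 / 3 * (1 - 0 * 0) :> R.
  by rewrite sqr_W_limit; ring.
apply: cvg_trans h; apply: near_eq_cvg; near=> n.
have : (0 < n)%N by near: n; exact: nbhs_infty_gt.
move: (n) => [//|m _]; rewrite VarX_W /w; set s := Num.sqrt _.
have s0 : s != 0 by rewrite sqrtr_eq0 -ltNge ltr0n.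
have -> : m.+1%:R = s ^+ 2 by rewrite sqr_sqrtr ?ler0n.
by field.
Unshelve. all: end_near. Qed.

Lemma VarX_limit_gt0 : 0 < 5 / 3 - pi / 2 :> R.
Proof. have [_ h] := @pi_bounds R; lra. Qed.

Lemma VarX_asymp :
  asymp_equiv (VarX R) (fun n => (5 / 3 - pi / 2) * n%:R ^+ 3).
Proof.
have v0 := lt0r_neq0 VarX_limit_gt0.
have h : VarX R n / n%:R ^+ 3 / (5 / 3 - pi / 2) @[n --> \oo] -->
    ((5 / 3 - pi / 2) / (5 / 3 - pi / 2) : R).
  by apply: cvgM; [exact: VarX_cvg|exact: cvg_cst].
rewrite divff// in h; apply: cvg_trans h; apply: near_eq_cvg; near=> n.
by rewrite -mulrA; congr (_ * _); rewrite [RHS]invfM mulrC.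
Unshelve. all: end_near. Qed.

Let c : R := (Num.sqrt 2 / 6) * (Num.sqrt (60 - 18 * pi) / Num.sqrt pi).

Lemma variation_ge0 : 0 <= c.
Proof. by rewrite mulr_ge0 ?divr_ge0 ?sqrtr_ge0. Qed.

(** Squaring removes the roots; [c] is then compared with other nonnegative numbers through its
    square, both to identify the limit and to bound the decimals. *)
Lemma sqr_variation : c ^+ 2 = 10 / (3 * pi) - 1.
Proof.
have pi0 := @pi_gt0 R; have [_ pih] := @pi_bounds R.
rewrite !exprMn !exprVn !sqr_sqrtr ?pi_ge0//; last by lra.
by move: (pi) pi0 {pih} => p p0; field; rewrite lt0r_neq0.
Qed.

Lemma variation_cvg : Num.sqrt (VarX R n) / EX R n @[n --> \oo] --> c.
Proof.
have v0 := VarX_limit_gt0; have L0 := W_limit_gt0; have pi0 := @pi_gt0 R.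
have -> : c = Num.sqrt (5 / 3 - pi / 2) / L.
  apply/eqP; rewrite -(@eqrXn2 _ 2) ?variation_ge0 ?divr_ge0 ?sqrtr_ge0 ?(ltW L0)//.
  rewrite sqr_variation exprMn exprVn sqr_W_limit sqr_sqrtr ?(ltW v0)//.
  by apply/eqP; move: (pi) pi0 {v0 L0} => p p0; field; rewrite lt0r_neq0.
have h : Num.sqrt (VarX R n / n%:R ^+ 3) / w n @[n --> \oo] -->
    Num.sqrt (5 / 3 - pi / 2) / L.
  apply: cvgM; last by apply: cvgV; [exact: lt0r_neq0|exact: W_cvg].
  exact: (cvg_comp _ _ VarX_cvg (@sqrt_continuous R _)).
apply: cvg_trans h; apply: near_eq_cvg; near=> n.
have : (0 < n)%N by near: n; exact: nbhs_infty_gt.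
move: (n) => [//|m _]; rewrite EX_W /w.
have s0 : Num.sqrt m.+1%:R != 0 :> R by rewrite sqrtr_eq0 -ltNge ltr0n.
have n0 : m.+1%:R != 0 :> R by rewrite pnatr_eq0.
have e : Num.sqrt (m.+1%:R ^+ 3) = m.+1%:R * Num.sqrt m.+1%:R :> R.
  by rewrite exprS mulrC sqrtrM ?sqr_ge0// sqrtr_sqr ger0_norm.
rewrite [VarX _ _ / _]mulrC sqrtrM ?invr_ge0 ?exprn_ge0// sqrtrV ?exprn_ge0// e invf_div.
by move: (Num.sqrt (VarX _ _)) ((W R _)^-1) => x y; field; rewrite ?nat1r s0 n0.
Unshelve. all: end_near. Qed.

Lemma variation_digits :
  has_decimal_expansion c [:: 2; 4; 7; 0; 4; 8; 4; 8; 5; 0]%N.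
Proof.
have [pil pih] := @pi_bounds R; have pi0 := @pi_gt0 R; have c0 := variation_ge0.
rewrite /has_decimal_expansion /decimal !big_ord_recr big_ord0 /=.
set d : R := (X in X <= _).
have d0 : 0 <= d by rewrite /d; lra.
have d1 : 0 <= d + 10 ^- 10 by rewrite /d; lra.
rewrite -(@ler_pXn2r _ 2) ?nnegrE// -(@ltr_pXn2r _ 2 isT c) ?nnegrE// sqr_variation.
(* Clearing the denominator [3 * pi] leaves inequalities linear in [pi], which its ten known
   decimals settle. *)
rewrite lerBrDr ltrBlDr ler_pdivlMr ?ltr_pdivrMr ?mulr_gt0//.
by apply/andP; split; rewrite /d; lra.
Qed.

End VarianceAsymptotics.

(* The limit c satisfies c ^+ 2 = 10 / (3 * pi) - 1, hence c = 0.24704848501 to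
   eleven decimals: the source prints its ninth and tenth decimals as 47 where
   the true ones are 50. *)
Theorem theorem2 (R : realType) :
  let c : R :=
    (Num.sqrt 2 / 6) * (Num.sqrt (60 - 18 * pi) / Num.sqrt pi) in
  [/\ forall n : nat, (0 < n)%N ->
        VarX R n = - W R n ^+ 2 - 17 / 6 * n%:R * W R n
                   + 5 / 3 * n%:R ^+ 2 * (n%:R - 1),
      asymp_equiv (VarX R) (fun n => (5 / 3 - pi / 2) * n%:R ^+ 3),
      ((fun n => Num.sqrt (VarX R n) / EX R n) @ \oo --> c)%classic &
      has_decimal_expansion c [:: 2; 4; 7; 0; 4; 8; 4; 8; 5; 0]%N].
Proof.
move=> c; split.
- by case=> // m _; exact: VarX_W.
- exact: VarX_asymp.
- exact: variation_cvg.
- exact: variation_digits.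
Qed.
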